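(* There exist absolute constants $c\in(0,1)$ and $K>0$ such that the following holds. For every integer $N\ge 1$ and every even integer $n\ge N$, there exists a 1--3 tree on $n$ vertices in which the number of distinct lengths of leaf-to-leaf paths lying in $\{0,1,\dots,N\}$ is at most $K N^{c}$.
   Context: A 1--3 tree is a tree in which every vertex has degree $1$ or $3$. A leaf is a vertex of degree $1$; a leaf-to-leaf path is a path whose endpoints are both leaves, its length is its number of edges, and a single vertex is considered a path of length $0$. *)

(* Defs.v *)
From mathcomp Require Import all_boot.

Set Implicit Arguments.
Unset Strict Implicit.
Unset Printing Implicit Defensive.

(* A finite simple graph is a symmetric irreflexive relation on a finType. *)

Section Graph.
Variables (T : finType) (e : rel T).

Definition simple_graph : Prop := symmetric e /\ irreflexive e.

Definition degree (x : T) : nat := #|[set y | e x y]|.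

Definition connected_graph : Prop := 0 < #|T| /\ forall x y, connect e x y.

(* The bound on [size s] is needed because, [e] being symmetric, the two
   endpoints of an edge form a [ucycle] of size 2. *)
Definition acyclic_graph : Prop :=
  forall s : seq T, 2 < size s -> ~ ucycle e s.

Definition tree : Prop :=
  [/\ simple_graph, connected_graph & acyclic_graph].

Definition tree13 : Prop :=
  tree /\ forall x, degree x = 1 \/ degree x = 3.

Definition leaf (x : T) : bool := degree x == 1.

(* In [path e x p] the starting vertex [x] is not listed in [p], so [size p] is
   the number of edges; [p = [::]] is the path of length 0. *)
Definition leaf_path (x : T) (p : seq T) : bool :=
  [&& path e x p, uniq (x :: p), leaf x & leaf (last x p)].

Definition leaf_path_length (l : nat) : bool :=
  [exists x : T, exists p : l.-tuple T, leaf_path x p].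

Definition leaf_path_lengths (N : nat) : {set 'I_N.+1} :=
  [set l : 'I_N.+1 | leaf_path_length l].

End Graph.

(* Main.v *)
Require Import Defs.
From mathcomp Require Import all_boot all_order all_algebra.
From mathcomp Require Import reals exp.
From mathcomp Require Import zify ring lra.

Import Order.TTheory GRing.Theory Num.Theory.

(** Let [m = 7 ^ k] with [m ^ 2 <= N], and let [A] be the set of integers with
    [k] base-7 digits, all in the perfect difference set [{0, 1, 3}]: every
    residue modulo [m] is a difference of two elements of [A], while [A + A]
    has at most [6 ^ k] elements. Hence every [i] has some [d i < m] such that
    [d i + i] and [d i - i] both lie in [A] modulo [m]. Hang a perfect binary
    tree of depth [d i] at the [i]-th vertex of a long path. For [i < j], leaves
    hanging at [i] and [j] are at distance
    [(j - i) + d i + d j + 2 = (d j + j) + (d i - i) + 2], which takes at most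
    [6 ^ k] values modulo [m], and two leaves hanging at the same vertex are at
    distance at most [2 m]. So only [O(N (6 / 7) ^ k)] lengths up to [N] occur.
    The number of vertices is adjusted by an almost perfect tree of depth at
    most [m] at one end of the path; this adds [O(3 ^ k)] residues. *)

(** * Binary trees, with vertices addressed by bit strings *)

Inductive btree := Leaf | Node of btree & btree.

Fixpoint nleaves t := if t is Node l r then nleaves l + nleaves r else 1.

Fixpoint addrs t : seq (seq bool) :=
  if t is Node l r then
    [::] :: map (cons false) (addrs l) ++ map (cons true) (addrs r)
  else [:: [::]].

Fixpoint depths t : seq nat :=
  if t is Node l r then map succn (depths l ++ depths r) else [:: 0].

(* Only pairs of distinct leaves are listed: distance 0 is left out. *)
Fixpoint leaf_dists t : seq nat :=
  if t is Node l r then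
    leaf_dists l ++ leaf_dists r ++
      [seq x + y + 2 | x <- depths l, y <- depths r]
  else [::].

(* Vertices are named by their path from the root; [planted t] adds a pendant
   leaf [[::]] above the root of [t]. *)
Definition planted t := [::] :: map (cons true) (addrs t).

Definition is_child (a b : seq bool) := (b == rcons a false) || (b == rcons a true).

Definition adj a b := is_child a b || is_child b a.

Lemma is_childP a b : reflect (exists c, b = rcons a c) (is_child a b).
Proof.
apply: (iffP orP) => [[/eqP ->|/eqP ->]|[[] ->]]; first by exists false.
- by exists true.
- by right.
- by left.
Qed.

Lemma adj_sym : symmetric adj.
Proof. by move=> a b; rewrite /adj orbC. Qed.

Lemma adj_irr : irreflexive adj.
Proof.
move=> a; apply/negP => /orP[] /is_childP[c] /(congr1 size);
  by rewrite size_rcons; lia.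
Qed.

Lemma nil_addrs t : [::] \in addrs t.
Proof. by case: t => [|l r]; rewrite inE. Qed.

Lemma cons_addrs_leaf b a : (b :: a \in addrs Leaf) = false.
Proof. by []. Qed.

Lemma mem_map_cons (c b : bool) a s :
  (b :: a \in map (cons c) s) = (b == c) && (a \in s).
Proof.
apply/mapP/andP => [[a' sa [-> ->]] | [/eqP -> sa]]; first by rewrite eqxx.
by exists a.
Qed.

Lemma cons_addrs b a l r :
  (b :: a \in addrs (Node l r)) = (a \in addrs (if b then r else l)).
Proof. by rewrite /= inE mem_cat !mem_map_cons; case: b; rewrite /= ?orbF. Qed.

Lemma cons_planted b a t : (b :: a \in planted t) = b && (a \in addrs t).
Proof. by rewrite inE /= mem_map_cons; case: b. Qed.

Lemma uniq_addrs t : uniq (addrs t).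
Proof.
have inj b : injective (cons b) by move=> x y [].
elim: t => //= l IHl r IHr; rewrite cat_uniq !(map_inj_uniq (inj _ _)) IHl IHr /= andbT.
apply/andP; split.
  by rewrite mem_cat; apply/negP => /orP[] /mapP[].
by apply/hasPn => x /mapP[y _ ->]; apply/negP => /mapP[].
Qed.

Lemma uniq_planted t : uniq (planted t).
Proof.
rewrite /= map_inj_uniq ?uniq_addrs ?andbT; last by move=> x y [].
by apply/negP => /mapP[].
Qed.

Lemma size_planted t : size (planted t) = (nleaves t).*2.
Proof.
rewrite /= size_map; elim: t => //= l IHl r IHr.
by rewrite size_cat !size_map; lia.
Qed.

Lemma addrs_prefix t z u : z ++ u \in addrs t -> z \in addrs t.
Proof.
elim: t z => [|l IHl r IHr] [|b z]; rewrite ?nil_addrs //.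
by rewrite !cons_addrs; case: b => [/IHr|/IHl].
Qed.

Lemma planted_prefix t z u : z ++ u \in planted t -> z \in planted t.
Proof.
by case: z => // b z; rewrite !cons_planted => /andP[-> /addrs_prefix].
Qed.

Lemma addrs_sibling t z b c : (rcons z b \in addrs t) = (rcons z c \in addrs t).
Proof.
elim: t z b c => [|l IHl r IHr] [|a z] b c; rewrite ?cons_addrs_leaf //= ?cons_addrs.
  by case: b; case: c; rewrite !nil_addrs.
by case: a.
Qed.

(** Testing one child is enough: by [addrs_sibling] the children of a vertex come in pairs. *)
Definition leaf_addr t a := (a \in addrs t) && (rcons a false \notin addrs t).

Lemma cons_leaf_addr b a l r :
  leaf_addr (Node l r) (b :: a) = leaf_addr (if b then r else l) a.
Proof. by rewrite /leaf_addr rcons_cons !cons_addrs. Qed.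

Lemma leaf_addr_depth t a : leaf_addr t a -> size a \in depths t.
Proof.
elim: t a => [|l IHl r IHr] [|b a]; first by rewrite inE.
- by rewrite /leaf_addr cons_addrs_leaf.
- by rewrite /leaf_addr [rcons _ _]/= cons_addrs !nil_addrs.
rewrite cons_leaf_addr => H.
apply/mapP; exists (size a) => //; rewrite mem_cat.
by case: b H => [/IHr|/IHl] ->; rewrite ?orbT.
Qed.

(** The two addresses part at their deepest common ancestor [z]; the first step below it on either
    side accounts for the 2. *)
Lemma leaf_addr_dist t z b u v :
  leaf_addr t (z ++ b :: u) -> leaf_addr t (z ++ ~~ b :: v) ->
  size u + size v + 2 \in leaf_dists t.
Proof.
elim: t z b u v => [|l IHl r IHr] z b u v; first by case: z => [|a z]; rewrite /leaf_addr cons_addrs_leaf.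
rewrite /= !mem_cat; case: z => [|a z]; rewrite /= !cons_leaf_addr.
  case: b => /= /leaf_addr_depth Hu /leaf_addr_depth Hv.
  - apply/orP; right; apply/orP; right.
    by rewrite (addnC (size u)); apply: (allpairs_f (fun x y => x + y + 2)).
  - apply/orP; right; apply/orP; right.
    by apply: (allpairs_f (fun x y => x + y + 2)).
by case: a => [/IHr H /H|/IHl H /H] ->; rewrite ?orbT.
Qed.

(* A simple path whose first step goes away from the root never turns back. *)
Lemma path_down p w b :
  path adj (rcons w b) p -> uniq [:: w, rcons w b & p] ->
  exists2 v, last (rcons w b) p = rcons w b ++ v & size p = size v.
Proof.
elim: p w b => [|y p IH] w b; first by exists [::]; rewrite ?cats0.
move=> /= /andP[/orP[] /is_childP[c Ec] Hp].
- rewrite Ec in Hp * => /andP[_ Hu].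
  have [//|v Ev ->] := IH _ _ Hp; exists (c :: v) => //.
  by rewrite Ev -cats1 -catA.
- by case/rcons_inj: Ec => -> _; rewrite !inE eqxx !orbT.
Qed.

(** The path climbs to an ancestor [z] and either stops there or descends. Being simple, it cannot
    descend into the child [c] it came from, and [path_down] excludes any further turn. *)
Lemma path_up p w b :
  path adj w p -> uniq [:: rcons w b, w & p] ->
  exists z c u v, [/\ rcons w b = z ++ c :: u, last w p = z ++ v,
    (size p).+1 = (size u).+1 + size v
    & v = [::] \/ exists v', v = ~~ c :: v'].
Proof.
elim: p w b => [|y p IH] w b.
  move=> _ _; exists w, b, [::], [::]; rewrite cats0 cats1; split=> //.
  by left.
move=> /= /andP[/orP[] /is_childP[c Ec] Hp].
- rewrite Ec in Hp * => /andP[Hb Hu].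
  have [//|v Ev Es] := path_down _ _ _ Hp.
  exists w, b, [::], (c :: v); split; rewrite ?cats1 //=; last 2 first.
  + by rewrite Es; lia.
  + right; exists v; congr cons.
    move: Hb; rewrite !inE !negb_or => /and3P[_ + _].
    by case: (b) (c) => [] []; rewrite ?eqxx.
  by rewrite Ev -cats1 -catA.
- rewrite Ec => /andP[_ Hu].
  have [//|z [d [u [v [E1 E2 E3 E4]]]]] := IH _ c Hp.
  exists z, d, (rcons u b), v; split=> //.
  + by rewrite E1 rcons_cat.
  + by rewrite size_rcons; lia.
Qed.

(** * The planted tree as a 1--3 tree, and its leaf-to-leaf path lengths *)

Section TreeGraph.
Variable t : btree.
Let n := size (planted t).

Definition label (i : 'I_n) := nth [::] (planted t) i.

Definition tree_rel (i j : 'I_n) := adj (label i) (label j).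

Lemma label_inj : injective label.
Proof.
move=> i j /eqP; rewrite nth_uniq ?uniq_planted // => /eqP.
exact: val_inj.
Qed.

Lemma label_mem i : label i \in planted t.
Proof. exact: mem_nth. Qed.

Lemma label_onto a : a \in planted t -> exists i, label i = a.
Proof.
move=> Ha; have Hi : index a (planted t) < n by rewrite index_mem.
by exists (Ordinal Hi); rewrite /label nth_index.
Qed.

Lemma map_label_enum : map label (enum 'I_n) = planted t.
Proof.
rewrite -[RHS](mkseq_nth [::]) /mkseq -val_enum_ord -map_comp.
exact: eq_map.
Qed.

Lemma tree_rel_sym : symmetric tree_rel.
Proof. by move=> i j; rewrite /tree_rel adj_sym. Qed.

Lemma degree_label i : degree tree_rel i =
  (label i != [::]) + (rcons (label i) false \in planted t)
  + (rcons (label i) true \in planted t).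
Proof.
set a := label i.
(* All possible neighbours of [a]: its parent [belast b a'], absent for the root, and its two
   children. *)
pose nb := (if a is b :: a' then [:: belast b a'] else [::])
           ++ [:: rcons a false; rcons a true].
have -> : degree tree_rel i = count (adj a) (planted t).
  rewrite /degree cardsE cardE /enum_mem size_filter -map_label_enum count_map.
  by rewrite enumT; apply: eq_count => j.
have adjE y : adj a y = (y \in nb).
  rewrite /adj /nb; case: (a) => [|b a'].
    by rewrite /= !inE /is_child; case: y => [|c y] //=; rewrite orbF.
  rewrite mem_cat orbC !inE; congr (_ || _).
  rewrite lastI; apply/is_childP/eqP => [[c /rcons_inj[<- _]] //|->].
  by exists (last b a').
have nb_uniq : uniq nb.
  rewrite /nb; case: (a) => [|b a'] //; rewrite cat_uniq /= !inE orbF.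
  have neq c : rcons (b :: a') c == belast b a' = false.
    by apply/negP => /eqP /(congr1 size); rewrite size_rcons size_belast /=; lia.
  rewrite -!rcons_cons !neq /=; apply/andP; split=> //.
  by apply/negP => /eqP[/rcons_inj[]].
rewrite -size_filter.
have -> : size (filter (adj a) (planted t)) = size (filter (mem (planted t)) nb).
  apply/perm_size/uniq_perm; rewrite ?filter_uniq ?uniq_planted //.
  by move=> y; rewrite !mem_filter adjE andbC.
have := label_mem i; rewrite -/a /nb; case: (a) => [|b a'] Ha.
  by rewrite size_filter [LHS]/= addn0.
have Hb : belast b a' \in planted t.
  by move: Ha; rewrite lastI -cats1 => /planted_prefix.
by rewrite size_filter [LHS]/= Hb addn0 addnA.
Qed.

Lemma leaf_label i : leaf tree_rel i =
  if label i is b :: a then leaf_addr t a else true.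
Proof.
rewrite /leaf degree_label; have := label_mem i.
case: (label i) => [|b a].
  by rewrite !cons_planted nil_addrs.
rewrite !cons_planted => /andP[-> Ha]; rewrite /leaf_addr Ha /=.
by rewrite (addrs_sibling t a true false); case: (_ \in _).
Qed.

Lemma degree_tree_rel i : degree tree_rel i = 1 \/ degree tree_rel i = 3.
Proof.
rewrite degree_label; have := label_mem i.
case: (label i) => [|b a].
  by rewrite !cons_planted nil_addrs; left.
rewrite !cons_planted => /andP[-> Ha] /=.
by rewrite (addrs_sibling t a true false); case: (_ \in _); [right|left].
Qed.

Lemma connected_tree_rel : connected_graph tree_rel.
Proof.
have [i0 E0] := label_onto [::] (mem_head _ _).
have conn a : a \in planted t -> forall i, label i = a -> connect tree_rel i0 i.
  elim/last_ind: a => [|a b IH] Ha i Ei.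
    by have -> : i = i0 by apply: label_inj; rewrite Ei E0.
  have Ha' : a \in planted t by move: Ha; rewrite -cats1 => /planted_prefix.
  have [j Ej] := label_onto _ Ha'.
  apply: connect_trans (IH Ha' j Ej) (connect1 _).
  by rewrite /tree_rel Ei Ej /adj; apply/orP; left; apply/is_childP; exists b.
split; first by rewrite card_ord.
move=> i j; apply: (@connect_trans _ _ i0).
  rewrite (sym_connect_sym tree_rel_sym).
  exact: (conn _ (label_mem i)).
exact: (conn _ (label_mem j)).
Qed.

(* A deepest vertex of a cycle would have two distinct parents. *)
Lemma acyclic_tree_rel : acyclic_graph tree_rel.
Proof.
move=> s s_gt2 /andP[cyc_s uniq_s].
have [i0 Hi0] : exists i, i \in s by case: (s) s_gt2 => // i s' _; exists i; rewrite mem_head.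
have [x Hx xmax] := arg_maxnP (fun i => size (label i)) Hi0.
have [k s' Es] := rot_to Hx.
have : cycle tree_rel (x :: s') by rewrite -Es rot_cycle.
have : uniq (x :: s') by rewrite -Es rot_uniq.
have : 2 < size (x :: s') by rewrite -Es size_rot.
have sub y : y \in s' -> size (label y) <= size (label x).
  move=> Hy; apply: xmax; change (y \in s).
  by rewrite -(mem_rot k) Es inE Hy orbT.
clear Es; case: s' sub => [|y [|z s']] // sub _ /= /and3P[_ Hy _].
rewrite rcons_path => /and3P[xy _ /andP[_ zx]].
have parent w : w \in [:: y, z & s'] -> adj (label x) (label w) ->
    exists c, label x = rcons (label w) c.
  move=> /sub Hw /orP[] /is_childP[c Ec]; last by exists c.
  by move: Hw; rewrite Ec size_rcons ltnn.
have [c Ec] := parent y (mem_head _ _) xy.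
have Hlast : last z s' \in [:: y, z & s'] by rewrite inE mem_last orbT.
have [|d Ed] := parent _ Hlast; first by rewrite adj_sym.
move: Ed; rewrite Ec => /rcons_inj[/label_inj Eyz _].
by move: Hy; rewrite Eyz mem_last.
Qed.

Lemma tree13_tree_rel : tree13 tree_rel.
Proof.
split; last exact: degree_tree_rel.
split; [split; [exact: tree_rel_sym|move=> i; exact: adj_irr]| |].
- exact: connected_tree_rel.
- exact: acyclic_tree_rel.
Qed.

(** The cases are a single vertex, a path with the pendant leaf as one end, and a path between two
    distinct leaves of [t]. *)
Lemma leaf_path_length_planted l : leaf_path_length tree_rel l ->
  [\/ l = 0, exists2 h, h \in depths t & l = h.+1 | l \in leaf_dists t].
Proof.
move=> /existsP[x /existsP[p]]; rewrite /leaf_path !leaf_label.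
move=> /and4P[Hp Hu Lx Ly].
rewrite -(size_tuple p) -(size_map label).
have : path adj (label x) (map label p) by rewrite path_map.
have : uniq (map label (x :: p)) by rewrite map_inj_uniq //; exact: label_inj.
move: Lx Ly; have := label_mem x; have := label_mem (last x p).
rewrite -last_map /=; case: (map _ _) => [|y q]; first by constructor 1.
move: (label x) => {Hp Hu} a.
(* A leaf with a vertex below it can only be the pendant leaf. *)
have leaf_child z c u : z ++ c :: u \in planted t ->
    (if z is _ :: z' then leaf_addr t z' else true) -> z = [::].
  case: z => // b z; rewrite /= cons_planted => /andP[_ Hz] /andP[_].
  rewrite -(addrs_sibling t z c) -cats1.
  suff -> : z ++ [:: c] \in addrs t by [].
  by apply: (addrs_prefix t _ u); rewrite -catA.
have leaf_top u : leaf_addr t u ->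
    exists2 h, h \in depths t & (size u).+1 = h.+1.
  by move=> /leaf_addr_depth; exists (size u).
move=> Hlast Ha La Ll Hu /= /andP[/orP[] /is_childP[c Ec] Hp].
- rewrite Ec /= in Hp Hu Hlast Ll *.
  have [v Ev Es] := path_down _ _ _ Hp Hu.
  have Ea : a = [::].
    by apply: (leaf_child _ c v) => //; move: Hlast; rewrite Ev cat_rcons.
  move: Hlast Ll; rewrite Ev Ea /= => Hlast Ll.
  by constructor 2; rewrite Es; apply: leaf_top Ll.
- rewrite Ec in Hu Ha La.
  have [z [d [u [v [E1 E2 E3 E4]]]]] := path_up _ _ _ Hp Hu.
  rewrite E1 in Ha La; rewrite /= E3; rewrite /= E2 in Hlast Ll.
  case: E4 => [Ev|[v' Ev]]; rewrite {}Ev in Hlast Ll E2 *.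
  + rewrite cats0 in Ll.
    have Ez := leaf_child _ _ _ Ha Ll; rewrite Ez /= in Ha La.
    by rewrite addn0; constructor 2; apply: leaf_top La.
  (* No path turns at [[::]], whose only child is [[:: true]]. *)
  + case: z Ha La Hlast Ll {E1 E2} => [|b z] /=.
      rewrite !cons_planted => /andP[db _] _.
      by rewrite db.
    move=> _ La _ Ll; constructor 3.
    have := leaf_addr_dist _ _ _ _ _ La Ll.
    by rewrite addn2 addSn addnS.
Qed.

End TreeGraph.

(** * Perfect and almost perfect trees, and the spine carrying them *)

Fixpoint perfect h := if h is h'.+1 then Node (perfect h') (perfect h') else Leaf.

Lemma nleaves_perfect h : nleaves (perfect h) = 2 ^ h.
Proof. by elim: h => //= h ->; rewrite expnS; lia. Qed.

Lemma depths_perfect h x : x \in depths (perfect h) -> x = h.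
Proof.
elim: h x => [|h IH] x /=; first by rewrite inE => /eqP.
by move=> /mapP[y + ->]; rewrite mem_cat => /orP[] /IH ->.
Qed.

Lemma leaf_dists_le t h :
  (forall x, x \in depths t -> x <= h) ->
  forall x, x \in leaf_dists t -> x <= h.*2.
Proof.
elim: t h => //= l IHl r IHr h dle.
have dl x : x \in depths l -> x.+1 <= h.
  by move=> Hx; apply: (dle x.+1); apply: map_f; rewrite mem_cat Hx.
have dr x : x \in depths r -> x.+1 <= h.
  by move=> Hx; apply: (dle x.+1); apply: map_f; rewrite mem_cat Hx orbT.
move=> x; rewrite !mem_cat => /or3P[Hx|Hx|/allpairsP[[u v] /= [Hu Hv ->]]].
- by apply: IHl Hx => y /dl /ltnW.
- by apply: IHr Hx => y /dr /ltnW.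
- by have := dl _ Hu; have := dr _ Hv; lia.
Qed.

(** Halving [r] into [r./2] and [uphalf r] keeps both parts within the bounds one level lower. *)
Lemma almost_perfect h r : 2 ^ h <= r <= 2 ^ h.+1 ->
  exists t, nleaves t = r /\
    forall x, x \in depths t -> x = h \/ x = h.+1.
Proof.
elim: h r => [|h IH] r Hr.
  have [->|->] : r = 1 \/ r = 2 by move: Hr; rewrite expn0 expn1; lia.
    by exists Leaf; split=> // x; rewrite inE => /eqP; left.
  by exists (Node Leaf Leaf); split=> // x; rewrite !inE orbb => /eqP; right.
have [|l [Nl dl]] := IH r./2; first by move: Hr; rewrite !expnS; lia.
have [|l' [Nl' dl']] := IH (uphalf r); first by move: Hr; rewrite !expnS; lia.
exists (Node l l'); split; first by rewrite /= Nl Nl'; lia.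
move=> x /mapP[y + ->]; rewrite mem_cat => /orP[/dl|/dl'] [] ->; by [left|right].
Qed.

Section Spine.
Variables (d : nat -> nat) (base : btree).

(** Indices decrease away from the root, with [base] below index 0, so induction on [s] adds trees
    at the top only. *)
Fixpoint spine s :=
  if s is s'.+1 then Node (perfect (d s')) (spine s') else base.

Lemma nleaves_spine s :
  nleaves (spine s) = \sum_(i < s) 2 ^ d i + nleaves base.
Proof.
elim: s => [|s IH]; first by rewrite big_ord0.
by rewrite big_ord_recr /= IH nleaves_perfect addnA (addnC (2 ^ _)).
Qed.

Lemma depths_spine s x : x \in depths (spine s) ->
  (exists2 i, i < s & x + i = s + d i) \/
  (exists2 h, h \in depths base & x = s + h).
Proof.
elim: s x => [|s IH] x; first by right; exists x.
move=> /mapP[y + ->]; rewrite mem_cat => /orP[/depths_perfect -> | /IH[[i Hi E]|[h Hh ->]]].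
- by left; exists s => //; lia.
- by left; exists i; lia.
- by right; exists h => //; lia.
Qed.

(** Two leaves lie both in the base, both in one perfect tree, in two perfect trees, or in a perfect
    tree and the base. The term [x + i] stands in for the subtraction [j - i]. *)
Lemma leaf_dists_spine s x : x \in leaf_dists (spine s) ->
  [\/ x \in leaf_dists base,
      exists i, x <= (d i).*2,
      exists i j, x + i = j + d j + d i + 2
    | exists j h, h \in depths base /\ x = j + d j + h + 2].
Proof.
elim: s => [|s IH]; first by constructor 1.
rewrite /= !mem_cat => /or3P[Hx|/IH //|/allpairsP[[u v] /= [Hu Hv ->]]].
  constructor 2; exists s; apply: leaf_dists_le Hx => y /depths_perfect -> //.
rewrite (depths_perfect _ _ Hu).
have [[i Hi E]|[h Hh ->]] := depths_spine _ _ Hv.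
- by constructor 3; exists i, s; lia.
- by constructor 4; exists s, h; split=> //; lia.
Qed.

End Spine.

(** Chooses the spine length for a given number of leaves; the remainder [r] goes to the base, and
    [r <= f s] will bound its depth. *)
Lemma greedy_sum (f : nat -> nat) l : (forall i, 0 < f i) -> 0 < l ->
  exists s r, l = \sum_(i < s) f i + r /\ 0 < r <= f s.
Proof.
move=> f0; elim: l => [//|[|l] IH] _.
  by exists 0, 1; rewrite big_ord0 f0.
have [//|s [r [-> /andP[r0 rf]]]] := IH.
have [lt|ge] := ltnP r (f s).
  by exists s, r.+1; rewrite addnS lt.
exists s.+1, 1; rewrite big_ord_recr /= f0; split=> //; lia.
Qed.

(** * Numbers with [k] base-7 digits from a prescribed set *)

Fixpoint digit_sums (D : seq nat) k :=
  if k is k'.+1 then [seq x + 7 * y | x <- D, y <- digit_sums D k'] else [:: 0].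

Lemma size_digit_sums D k : size (digit_sums D k) = size D ^ k.
Proof. by elim: k => //= k IH; rewrite size_allpairs IH expnS. Qed.

Lemma mem_digit_sumsS D k a :
  reflect (exists x y, [/\ x \in D, y \in digit_sums D k & a = x + 7 * y])
          (a \in digit_sums D k.+1).
Proof.
apply: (iffP allpairsP) => [[[x y] [/= Hx Hy ->]]|[x [y [Hx Hy ->]]]].
  by exists x, y.
by exists (x, y).
Qed.

(* [{0,1,3}] is a perfect difference set modulo 7: every residue modulo 7 is
   a difference of two of its elements, but it has only 6 sums. *)
Notation singer := [:: 0; 1; 3].
Notation singer_sums := [:: 0; 1; 2; 3; 4; 6].

(** Addition is digit by digit, without carries, since two digits from [singer] sum to at most 6. *)
Lemma digit_sums_add k a b :
  a \in digit_sums singer k -> b \in digit_sums singer k ->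
  a + b \in digit_sums singer_sums k.
Proof.
elim: k a b => [|k IH] a b; first by rewrite !inE => /eqP -> /eqP ->.
move=> /mem_digit_sumsS[a0 [a1 [A0 A1 ->]]] /mem_digit_sumsS[b0 [b1 [B0 B1 ->]]].
apply/mem_digit_sumsS; exists (a0 + b0), (a1 + b1); rewrite IH //; split=> //.
  by move: A0 B0; rewrite !inE => /or3P[] /eqP -> /or3P[] /eqP ->.
by lia.
Qed.

Lemma digit_sums_diff k x : exists a b,
  [/\ a \in digit_sums singer k, b \in digit_sums singer k
    & a = x + b %[mod 7 ^ k]].
Proof.
elim: k x => [|k IH] x; first by exists 0, 0; rewrite !modn1.
(* The lowest digits are settled modulo 7; the quotient [c], with any carry, goes to the induction
   hypothesis. *)
have [a0 [b0 [c [A0 B0 E]]]] : exists a0 b0 c,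
    [/\ a0 \in singer, b0 \in singer & x + b0 = a0 + 7 * c].
  have : x %% 7 < 7 by rewrite ltn_mod.
  have Ex := divn_eq x 7.
  case Er : (x %% 7) Ex => [|[|[|[|[|[|[|]]]]]]] Ex // _.
  - by exists 0, 0, (x %/ 7); split=> //; lia.
  - by exists 1, 0, (x %/ 7); split=> //; lia.
  - by exists 3, 1, (x %/ 7); split=> //; lia.
  - by exists 3, 0, (x %/ 7); split=> //; lia.
  - by exists 0, 3, (x %/ 7).+1; split=> //; lia.
  - by exists 1, 3, (x %/ 7).+1; split=> //; lia.
  - by exists 0, 1, (x %/ 7).+1; split=> //; lia.
have [a1 [b1 [A1 B1 E1]]] := IH c.
exists (a0 + 7 * a1), (b0 + 7 * b1); split.
- by apply/mem_digit_sumsS; exists a0, a1.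
- by apply/mem_digit_sumsS; exists b0, b1.
apply/eqP; have -> : x + (b0 + 7 * b1) = a0 + 7 * (c + b1) by lia.
by rewrite eqn_modDl expnS -!muln_modr E1.
Qed.

Lemma spine_heights k : exists d : nat -> nat, forall i, d i < 7 ^ k /\
  exists a b, [/\ a \in digit_sums singer k, b \in digit_sums singer k,
    i + d i = a %[mod 7 ^ k] & d i = i + b %[mod 7 ^ k]].
Proof.
pose S := digit_sums singer k.
(* Stated with the boolean [has], so that [xchoose] turns the existence for each [i] into a
   function. *)
pose P i d := (d < 7 ^ k) && has (fun a => has (fun b =>
  (i + d == a %[mod 7 ^ k]) && (d == i + b %[mod 7 ^ k])) S) S.
have ex i : exists d, P i d.
  (* Represent [2 i] as a difference: if [a = 2 i + b] modulo [7 ^ k], then [d = i + b] gives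
     [i + d = a]. *)
  have [a [b [Ha Hb E]]] := digit_sums_diff k (i + i).
  exists ((i + b) %% 7 ^ k); rewrite /P ltn_mod expn_gt0 /=.
  apply/hasP; exists a => //; apply/hasP; exists b => //.
  by rewrite modnDmr modn_mod addnA E !eqxx.
exists (fun i => xchoose (ex i)) => i.
have /andP[-> /hasP[a Ha /hasP[b Hb /andP[/eqP E1 /eqP E2]]]] := xchooseP (ex i).
by split=> //; exists a, b.
Qed.

(** * Counting the lengths up to [N] *)

Lemma card_residues N m (X : seq nat) (P : {set 'I_N.+1}) B :
  0 < m ->
  (forall l, l \in P -> (l <= B) || (l %% m \in map (modn^~ m) X)) ->
  #|P| <= B.+1 + (N %/ m).+1 * size X.
Proof.
move=> m0 HP.
(* The candidates are the numbers up to [B], and one number for each quotient by [m] and each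
   residue from [X]. *)
pose G := iota 0 B.+1 ++ [seq y * m + x %% m | y <- iota 0 (N %/ m).+1, x <- X].
have -> : B.+1 + (N %/ m).+1 * size X = size G.
  by rewrite size_cat size_allpairs !size_iota.
rewrite cardE -(size_map val); apply: uniq_leq_size.
  by rewrite map_inj_uniq ?enum_uniq //; exact: val_inj.
move=> _ /mapP[l + ->]; rewrite mem_enum => /HP; rewrite /G mem_cat.
case/orP => [lB|/mapP[x Hx E]].
  by rewrite mem_iota add0n ltnS lB.
apply/orP; right; apply/allpairsP; exists (l %/ m, x); split=> //.
  by rewrite mem_iota add0n ltnS /= leq_div2r // -ltnS.
by rewrite /= -E -divn_eq.
Qed.

Lemma few_lengths k N n : 7 ^ k * 7 ^ k <= N -> 0 < n -> ~~ odd n ->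
  exists e : rel 'I_n,
    tree13 e /\ #|leaf_path_lengths e N| * 7 ^ k <= 15 * (N * 6 ^ k).
Proof.
set m := 7 ^ k => mN n0 n_even.
have m0 : 0 < m by rewrite expn_gt0.
have [d Hd] := spine_heights k; rewrite -/m in Hd.
have [||s [r [El /andP[r0 rd]]]] := greedy_sum (fun i => 2 ^ d i) n./2.
- by move=> i; rewrite expn_gt0.
- by lia.
have [|base [Nb Db]] := almost_perfect (trunc_log 2 r) r.
  by rewrite trunc_logP // ltnW // trunc_log_ltn.
set h := trunc_log 2 r in Db.
(* Here [2 ^ h <= r <= 2 ^ d s], so [h <= d s < m]; distances inside the base are then at most
   [2 m]. *)
have hm : h < m.
  apply: leq_ltn_trans (proj1 (Hd s)).
  by rewrite -(leq_exp2l _ _ (ltnSn 1)); apply: leq_trans rd; apply: trunc_logP.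
pose t := spine d base s.
have En : n = size (planted t) by rewrite size_planted nleaves_spine Nb -El; lia.
rewrite {}En {n n0 n_even El}; exists (tree_rel t); split; first exact: tree13_tree_rel.
pose A := digit_sums singer k.
(* In order: two perfect trees; a perfect tree and a base leaf, of depth [h] or [h.+1]; the pendant
   leaf and a perfect tree; the pendant leaf and the base. *)
pose X := [seq x + 2 | x <- digit_sums singer_sums k] ++
  [seq a + h + 2 | a <- A] ++ [seq a + h.+1 + 2 | a <- A] ++
  [seq s + b + 1 | b <- A] ++ [:: s + h + 1; s + h.+1 + 1].
have sX : size X <= 6 * 6 ^ k.
  rewrite !size_cat !size_map !size_digit_sums /=.
  have : 3 ^ k <= 6 ^ k by elim: (k) => // j; rewrite !expnS; lia.
  have : 0 < 6 ^ k by rewrite expn_gt0.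
  lia.
have inX l x : x \in X -> l = x %[mod m] -> l %% m \in map (modn^~ m) X.
  by move=> Hx ->; apply: (map_f (modn^~ m)).
have lenX l : leaf_path_length (tree_rel t) l ->
    (l <= m.*2) || (l %% m \in map (modn^~ m) X).
  move=> /leaf_path_length_planted[->|[x Hx ->]|Hl] //.
    apply/orP; right.
    have [[i _ E]|[h' /Db Hh ->]] := depths_spine _ _ _ _ Hx.
      have [_ [a [b [Ha Hb _ Eb]]]] := Hd i.
      apply: (inX _ (s + b + 1)).
        by rewrite !mem_cat (map_f (fun b => s + b + 1)) ?orbT.
      apply/eqP; rewrite -(eqn_modDr i).
      have -> : x.+1 + i = s + 1 + d i by lia.
      have -> : s + b + 1 + i = s + 1 + (i + b) by lia.
      by rewrite eqn_modDl Eb.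
    apply: (inX _ (s + h' + 1)); last by congr (_ %% _); lia.
    by rewrite !mem_cat; case: Hh => ->; rewrite !inE eqxx ?orbT.
  have [Hb|[i Hi]|[i [j E]]|[j [h' [/Db Hh E]]]] := leaf_dists_spine _ _ _ _ Hl.
  - apply/orP; left; apply: leaf_dists_le Hb => y /Db; lia.
  - by apply/orP; left; have := proj1 (Hd i); lia.
  - apply/orP; right.
    have [_ [a [_ [Ha _ Ea _]]]] := Hd j; have [_ [_ [b [_ Hb _ Eb]]]] := Hd i.
    apply: (inX _ (a + b + 2)).
      by rewrite mem_cat (map_f (fun x => x + 2)) ?digit_sums_add.
    (* Adding [i] to both sides avoids the subtraction in [d i - i]. *)
    apply/eqP; rewrite -(eqn_modDr i) E.
    have -> : a + b + 2 + i = a + (i + b) + 2 by lia.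
    by rewrite eqn_modDr -modnDm Ea Eb modnDm.
  - apply/orP; right.
    have [_ [a [_ [Ha _ Ea _]]]] := Hd j.
    apply: (inX _ (a + h' + 2)).
      rewrite !mem_cat; case: Hh => ->.
        by rewrite (map_f (fun a => a + h + 2)) ?orbT.
      by rewrite (map_f (fun a => a + h.+1 + 2)) ?orbT.
    by apply/eqP; rewrite E !eqn_modDr Ea.
have card_le : #|leaf_path_lengths (tree_rel t) N| <= m.*2.+1 + (N %/ m).+1 * size X.
  by apply: card_residues => // l; rewrite inE => /lenX.
have p0 : 0 < 6 ^ k by rewrite expn_gt0.
have Nm : N %/ m * m <= N by rewrite leq_trunc_div.
have mN' : m <= N by apply: leq_trans mN; rewrite leq_pmulr.
apply: leq_trans (leq_mul card_le (leqnn m)) _.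
apply: (@leq_trans ((m.*2.+1 + (N %/ m).+1 * (6 * 6 ^ k)) * m)).
  by rewrite leq_mul2r leq_add2l leq_mul2l sX !orbT.
have -> : (m.*2.+1 + (N %/ m).+1 * (6 * 6 ^ k)) * m
  = 2 * (m * m) + m + 6 * ((N %/ m * m + m) * 6 ^ k) by lia.
(* As [m * m <= N] and [m <= N], the three terms are at most [2 N], [N] and [12 N 6 ^ k], whence the
   constant 15. *)
have : (N %/ m * m + m) * 6 ^ k <= (N + N) * 6 ^ k by rewrite leq_mul2r leq_add ?orbT.
have : N * 1 <= N * 6 ^ k by rewrite leq_mul2l p0 orbT.
lia.
Qed.

(** * From powers of 7 to a real power of [N] *)

Local Open Scope ring_scope.

Theorem theorem1p6 (R : realType) :
  exists c K : R,
    [/\ 0 < c, c < 1, 0 < K &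
      forall N n : nat, (1 <= N)%N -> (N <= n)%N -> ~~ odd n ->
        exists e : rel 'I_n,
          tree13 e /\ #|leaf_path_lengths e N|%:R <= K * (N%:R `^ c)].
Proof.
pose delta : R := ln (7 / 6) / (2 * ln 7).
have ln7 : 0 < ln (7 : R) by rewrite ln_gt0 //; lra.
have ln76 : 0 < ln (7 / 6 : R) by rewrite ln_gt0 //; lra.
have ln76_lt : ln (7 / 6 : R) < ln 7 by rewrite ltr_ln ?posrE; lra.
have delta_gt0 : 0 < delta by rewrite divr_gt0 // mulr_gt0.
have delta_lt1 : delta < 1.
  by rewrite /delta ltr_pdivrMr ?mulr_gt0 //; lra.
(* The factor [7 / 6] pays for the gap between [49 ^ k] and [49 ^ k.+1], between which [N] lies. *)
exists (1 - delta), (15 * (7 / 6)); split; [lra|lra|lra|].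
move=> N n N1 Nn n_even.
(* The largest [k] with [(7 ^ k) ^ 2 <= N], as [few_lengths] requires. *)
pose k := trunc_log 49 N.
have [Nlow Nup] : (49 ^ k <= N)%N /\ (N < 49 ^ k.+1)%N.
  by split; [apply: trunc_logP|apply: trunc_log_ltn].
have [||//|e [e13 card_e]] := few_lengths k N n.
- by rewrite -expnMn.
- exact: leq_trans N1 Nn.
exists e; split=> //.
have N0 : 0 < N%:R :> R by rewrite ltr0n.
(* [delta] is chosen so that [49 `^ delta = 7 / 6]. *)
have Ndelta : N%:R `^ delta <= (7 / 6) ^+ k.+1 :> R.
  apply: (@le_trans _ _ ((7 ^+ (2 * k.+1)) `^ delta)).
    apply: ge0_ler_powR; rewrite ?nnegrE ?exprn_ge0 //; [exact: ltW|].
    by rewrite exprM -!natrX ler_nat ltnW.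
  rewrite -powR_mulrn // -powRrM /powR.
  rewrite (_ : (7 : R) == 0 = false); last by apply/negbTE; rewrite pnatr_eq0.
  rewrite (_ : _ * delta * ln 7 = k.+1%:R * ln (7 / 6)); last first.
    by rewrite /delta natrM; field; rewrite gt_eqF.
  by rewrite mulrC mulr_natr -lnXn ?lnK ?posrE ?exprn_gt0 //; lra.
have NE : N%:R `^ (1 - delta) * N%:R `^ delta = N%:R :> R.
  by rewrite -powRD ?subrK ?powRr1 // ?ltW // gt_eqF // implybT.
have pw : 0 <= N%:R `^ (1 - delta) :> R by exact: powR_ge0.
have m0 : 0 < 7 ^+ k :> R by rewrite exprn_gt0.
rewrite -(ler_pM2r m0).
apply: (@le_trans _ _ (15 * (N%:R * 6 ^+ k))).
  by rewrite -!natrX -!natrM ler_nat.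
rewrite -{1}NE.
have -> : 15 * (7 / 6) * N%:R `^ (1 - delta) * 7 ^+ k =
  15 * (N%:R `^ (1 - delta) * (7 / 6) ^+ k.+1 * 6 ^+ k) :> R.
  by rewrite exprS expr_div_n; field; rewrite expf_neq0 // pnatr_eq0.
rewrite ler_pM2l // ler_wpM2r ?exprn_ge0 //.
by rewrite ler_wpM2l.
Qed.
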